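(* Let $P$ be a monotone increasing property of digraphs, and let $P'$ be a property of (undirected) graphs such that whenever a graph satisfies $P'$, some orientation of it satisfies $P$. Then for every finite simple undirected graph $G$, the number of subgraphs of $G$ satisfying $P'$ is at most the number of orientations of $G$ satisfying $P$.
   Context: A subgraph of $G=(V,E)$ means a spanning subgraph $(V,X)$ with $X\subseteq E$. An orientation of a graph assigns a direction to each of its edges. A property $P$ of digraphs is monotone increasing if whenever a digraph $D$ on vertex set $V$ satisfies $P$, every digraph on $V$ whose arc set contains the arcs of $D$ also satisfies $P$. *)

(* Defs.v *)
From HB Require Import structures.
From mathcomp Require Import all_boot.
From mathcomp Require Import boolp.

Set Implicit Arguments.
Unset Strict Implicit.
Unset Printing Implicit Defensive.

(* An edge is a two-element set of vertices, so there are no loops and no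
   multiple edges. *)
Record sgraph (V : finType) := SGraph {
  edges : {set {set V}};
  edges_card2 : [forall e in edges, #|e| == 2]
}.

HB.instance Definition _ (V : finType) := [isSub for @edges V].
HB.instance Definition _ (V : finType) := [Countable of sgraph V by <:].
HB.instance Definition _ (V : finType) := [Finite of sgraph V by <:].

(* A digraph on V is its set of arcs; loops and pairs of opposite arcs are
   allowed. *)
Definition digraph (V : finType) := {set V * V}.

Definition graph_property := forall V : finType, sgraph V -> Prop.
Definition digraph_property := forall V : finType, digraph V -> Prop.

Definition monotone_increasing (P : digraph_property) : Prop :=
  forall (V : finType) (D D' : digraph V), D \subset D' -> P V D -> P V D'.

Definition is_subgraph (V : finType) (H G : sgraph V) : bool :=
  edges H \subset edges G.

(* (+) is exclusive or: exactly one of the two directions is chosen. *)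
Definition is_orientation (V : finType) (D : digraph V) (G : sgraph V) : bool :=
  [forall x, forall y, ((x, y) \in D) ==> ([set x; y] \in edges G)] &&
  [forall x, forall y,
     ([set x; y] \in edges G) ==> (((x, y) \in D) (+) ((y, x) \in D))].

Definition num_subgraphs (P' : graph_property) (V : finType) (G : sgraph V) : nat :=
  #|[set H : sgraph V | is_subgraph H G && `[< P' V H >]]|.

Definition num_orientations (P : digraph_property) (V : finType) (G : sgraph V) : nat :=
  #|[set D : digraph V | is_orientation D G && `[< P V D >]]|.

(* Main.v *)
Require Import Defs.
From mathcomp Require Import all_boot.
From mathcomp Require Import boolp.

(** Relative to a reference orientation, the orientations of [G] are the subsets
    of its edge set [E].  If a subgraph [H] has an orientation satisfying [P],
    then by monotonicity every extension of it to [G] satisfies [P]: the family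
    of orientations satisfying [P] contains a whole subcube in the directions
    [E \ H], i.e. it strongly shatters [E \ H].  The theorem thus follows from
    the fact that a set family strongly shatters at most as many sets as it has
    members. *)

Set Implicit Arguments.
Unset Strict Implicit.
Unset Printing Implicit Defensive.

Section StrongShattering.

Variable T : finType.
Implicit Types (E S B X : {set T}) (A : {set {set T}}).

(** The condition on [X] describes the subcube through [B] with free directions [S]. The ground set
    [E] is a parameter so that an induction can delete elements from it. *)
Definition strongly_shattered E A : {set {set T}} :=
  [set S in powerset E | [exists B : {set T} in powerset E, forall X : {set T} in powerset E,
     (X :\: S == B :\: S) ==> (X \in A)]].

Lemma strongly_shatteredP E A S :
  reflect (S \subset E /\ exists2 B : {set T}, B \subset E &
             forall X, X \subset E -> X :\: S = B :\: S -> X \in A)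
          (S \in strongly_shattered E A).
Proof.
rewrite inE powersetE; apply: (iffP andP) => -[sSE].
  case/existsP=> B /andP[]; rewrite powersetE => sBE /forallP BP.
  split=> //; exists B => // X sXE eqX.
  by move: (BP X); rewrite powersetE sXE eqX eqxx.
case=> B sBE BP; split=> //; apply/existsP; exists B; rewrite powersetE sBE /=.
apply/forallP=> X; apply/implyP; rewrite powersetE => sXE.
by apply/implyP => /eqP; apply: BP.
Qed.

(* Splitting [A] by membership of [e]: a shattered set avoiding [e] is shattered
   by one of the two halves, one containing [e] (minus [e]) by both. *)
Lemma card_strongly_shattered E A : #|strongly_shattered E A| <= #|A|.
Proof.
have [n] := ubnP #|E|; elim: n E A => // n IHn E A; rewrite ltnS => leEn.
have [->|[e eE]] := set_0Vmem E.
  (* Over an empty ground set only [set0] can be shattered, and its subcube is the single point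
     [set0], which then lies in [A]. *)
  apply/subset_leq_card/subsetP=> S /strongly_shatteredP[].
  rewrite subset0 => /eqP-> [B]; rewrite subset0 => /eqP-> BP.
  exact: BP (sub0set _) erefl.
pose A0 := A :\: [set X : {set T} | e \in X].
pose A1 := [set X :\ e | X : {set T} in A :&: [set X : {set T} | e \in X]].
have leA : #|A0| + #|A1| <= #|A|.
  rewrite -(cardsID [set X : {set T} | e \in X] A) addnC leq_add2r.
  exact: leq_imset_card.
have inA0 X : X \subset E :\ e -> X \in A -> X \in A0.
  by rewrite subsetD1 => /andP[_ neX] AX; rewrite !inE neX.
have inA1 X : X \subset E :\ e -> e |: X \in A -> X \in A1.
  rewrite subsetD1 => /andP[_ neX] AX; apply/imsetP; exists (e |: X).
    by rewrite !inE eqxx AX.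
  by rewrite setU1K.
have sUE X : X \subset E :\ e -> e |: X \subset E.
  by rewrite subsetD1 subUset sub1set eE => /andP[].
have sDE X : X \subset E :\ e -> X \subset E by rewrite subsetD1 => /andP[].
have ltEn : #|E :\ e| < n by rewrite (cardsD1 e E) eE in leEn.
apply: leq_trans leA; apply: leq_trans (leq_add (IHn _ A0 ltEn) (IHn _ A1 ltEn)).
set s0 := strongly_shattered _ A0; set s1 := strongly_shattered _ A1.
(* Shattered sets avoiding [e] are counted by the union of [s0] and [s1], those containing [e] by
   the intersection. *)
rewrite -cardsUI -(cardsID [set S : {set T} | e \in S]) addnC leq_add //.
  apply/subset_leq_card/subsetP=> S; rewrite inE [S \in [set _ | _]]inE.
  case/andP=> neS /strongly_shatteredP[sSE [B sBE BP]].
  have sSE' : S \subset E :\ e by rewrite subsetD1 sSE.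
  (* As [e] is not in [S], it is a fixed coordinate of the subcube, so [B] decides which half
     contains it. *)
  rewrite inE; case: (boolP (e \in B)) => eB; apply/orP; [right|left].
    apply/strongly_shatteredP; split=> //; exists (B :\ e); first exact: setSD.
    move=> X sX eqX; apply: (inA1 _ sX); apply: BP (sUE _ sX) _.
    apply/setP=> x; move/setP/(_ x): eqX; rewrite !inE.
    by case: eqVneq => [->|_] //=; rewrite neS eB.
  apply/strongly_shatteredP; split=> //; exists B; first by rewrite subsetD1 sBE.
  by move=> X sX eqX; apply: (inA0 _ sX); apply: BP (sDE _ sX) eqX.
have injD : {in strongly_shattered E A :&: [set S : {set T} | e \in S] &,
              injective (fun S => S :\ e)}.
  move=> S S' /setIP[_]; rewrite inE => eS /setIP[_]; rewrite inE => eS' eqS.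
  by rewrite -(setD1K eS) eqS setD1K.
rewrite -(card_in_imset injD); apply/subset_leq_card/subsetP=> _ /imsetP[S + ->].
case/setIP=> /strongly_shatteredP[sSE [B sBE BP]]; rewrite inE => eS.
(* Here [e] is a free direction: the subcube contains [X] both with and without [e]. *)
have BP' X : X :\: (S :\ e) = (B :\ e) :\: (S :\ e) ->
    X :\: S = B :\: S /\ (e |: X) :\: S = B :\: S.
  move=> eqX; split; apply/setP=> x; move/setP/(_ x): eqX; rewrite !inE;
    by case: eqVneq => [->|_] //=; rewrite eS.
rewrite inE; apply/andP; split; apply/strongly_shatteredP.
  split; [exact: setSD | exists (B :\ e); first exact: setSD].
  by move=> X sX /BP'[eqX _]; apply: (inA0 _ sX); apply: BP (sDE _ sX) eqX.
split; [exact: setSD | exists (B :\ e); first exact: setSD].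
by move=> X sX /BP'[_ eqX]; apply: (inA1 _ sX); apply: BP (sUE _ sX) eqX.
Qed.

End StrongShattering.

Section Flip.

Variables (V : finType) (G : sgraph V).

(* The reference orientation points from lower to higher rank; [X] is the set of
   edges to be reversed. *)
Definition flip (X : {set {set V}}) : digraph V :=
  [set p | ([set p.1; p.2] \in edges G) &&
           ((enum_rank p.1 < enum_rank p.2) (+) ([set p.1; p.2] \in X))].

Lemma edge_neq (H : sgraph V) x y : [set x; y] \in edges H -> x != y.
Proof.
move=> Hxy; have /forallP/(_ [set x; y]) := edges_card2 H.
by rewrite Hxy cards2 eqSS eqb1.
Qed.

Lemma enum_rank_gtn (x y : V) :
  x != y -> (enum_rank y < enum_rank x) = ~~ (enum_rank x < enum_rank y).
Proof.
move=> nxy; rewrite -leqNgt ltn_neqAle andb_idl // => _.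
by rewrite (inj_eq val_inj) (inj_eq enum_rank_inj) eq_sym.
Qed.

Lemma flip_orientation X : is_orientation (flip X) G.
Proof.
apply/andP; split; apply/forallP=> x; apply/forallP=> y; apply/implyP.
  by rewrite inE => /andP[].
move=> Gxy; rewrite !inE /= [[set y; x]]setUC Gxy /=.
rewrite (enum_rank_gtn (edge_neq Gxy)).
by case: (_ < _); case: (_ \in X).
Qed.

(** For an edge with ends [x] and [y], the presence of the arc [(x, y)] reveals whether the edge was
    reversed. *)
Lemma flip_inj : {in powerset (edges G) &, injective flip}.
Proof.
move=> X Y; rewrite !powersetE => sXG sYG eqXY; apply/setP=> e.
case: (boolP (e \in edges G)) => [Ge|nGe]; last first.
  by rewrite (contraNF (subsetP sXG e) nGe) (contraNF (subsetP sYG e) nGe).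
have /forallP/(_ e) := edges_card2 G; rewrite Ge => /cards2P[x [y [_ def_e]]].
move/setP/(_ (x, y)): eqXY; rewrite !inE /= -def_e Ge /=.
exact: addbI.
Qed.

Lemma flip_extends (H : sgraph V) D : is_subgraph H G -> is_orientation D H ->
  exists2 B : {set {set V}}, B \subset edges G &
    forall X, X :\: (edges G :\: edges H) = B :\: (edges G :\: edges H) ->
      D \subset flip X.
Proof.
move=> sHG /andP[/forallP DH /forallP HD].
have {}DH x y : (x, y) \in D -> [set x; y] \in edges H.
  by move: (DH x) => /forallP/(_ y)/implyP.
have {}HD x y : [set x; y] \in edges H -> ((x, y) \in D) (+) ((y, x) \in D).
  by move: (HD x) => /forallP/(_ y)/implyP.
(* [B] collects the edges that [D] directs against the reference; the hypothesis on [X] makes it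
   agree with [B] on the edges of [H]. *)
exists [set [set p.1; p.2] | p in D & enum_rank p.2 < enum_rank p.1].
  apply/subsetP=> _ /imsetP[[x y] /setIdP[Dxy _] ->].
  exact: (subsetP sHG) (DH _ _ Dxy).
move=> X eqX; apply/subsetP=> -[x y] Dxy; have Hxy := DH _ _ Dxy.
rewrite inE /= (subsetP sHG _ Hxy) /=.
move/setP/(_ [set x; y]): eqX; rewrite [LHS]inE [RHS]inE in_setD Hxy /= => ->.
have nxy := edge_neq Hxy; case: ltnP => [ltxy|]; last first.
  rewrite leqNgt -(enum_rank_gtn nxy) => ltyx /=.
  by apply/imsetP; exists (x, y); rewrite // !inE Dxy.
(* A descending arc of [D] on the same edge would have to be [(y, x)], but [D] already contains
   [(x, y)]. *)
rewrite /=; apply/negP => /imsetP[[x' y'] /setIdP[/= Dxy' lt'] eqs].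
have nDyx : (y, x) \notin D by move: (HD _ _ Hxy); rewrite Dxy.
have nxy' := edge_neq (DH _ _ Dxy').
have : x' \in [set x; y] by rewrite eqs !inE eqxx.
have : y' \in [set x; y] by rewrite eqs !inE eqxx orbT.
rewrite !inE => /orP[]/eqP ey /orP[]/eqP ex; subst x' y'.
- by rewrite eqxx in nxy'.
- by rewrite Dxy' in nDyx.
- by rewrite ltnNge (ltnW ltxy) in lt'.
- by rewrite eqxx in nxy'.
Qed.

End Flip.

Theorem theorem3p13 (P : digraph_property) (P' : graph_property)
  (monoP : monotone_increasing P)
  (P'P : forall (V : finType) (G : sgraph V), P' V G ->
     exists D : digraph V, is_orientation D G /\ P V D)
  (V : finType) (G : sgraph V) :
  num_subgraphs P' G <= num_orientations P G.
Proof.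
pose A := [set X in powerset (edges G) | `[< P V (flip G X) >]].
apply: (@leq_trans #|A|); last first.
  rewrite -(card_in_imset (f := flip G) (D := A)); last first.
    by move=> X Y /setIdP[sX _] /setIdP[sY _]; apply: flip_inj.
  apply/subset_leq_card/subsetP=> _ /imsetP[X /setIdP[_ PX] ->].
  by rewrite inE flip_orientation.
apply: leq_trans (card_strongly_shattered (edges G) A).
(* Complementation in [edges G] is injective on subgraphs and sends those satisfying [P'] to sets
   shattered by [A]. *)
rewrite /num_subgraphs -(card_in_imset (f := fun H => edges G :\: edges H)).
  apply/subset_leq_card/subsetP=> _ /imsetP[H + ->].
  rewrite inE => /andP[sHG /asboolP /P'P[D [DH PD]]].
  have [B sBG BP] := flip_extends sHG DH.
  apply/strongly_shatteredP; split; first exact: subsetDl.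
  exists B => // X sXG eqX; rewrite inE powersetE sXG /=; apply/asboolP.
  exact: monoP (BP X eqX) PD.
move=> H K; rewrite !inE => /andP[sHG _] /andP[sKG _] eqHK; apply: val_inj => /=.
have setDK (K' : sgraph V) : is_subgraph K' G ->
    edges G :\: (edges G :\: edges K') = edges K'.
  by move=> /setIidPr sK'G; rewrite setDDr setDv set0U.
by rewrite -(setDK H sHG) -(setDK K sKG) eqHK.
Qed.
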